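(* Let $k$ be a commutative ring and let $\mathcal{D}$ be a small category. If $\mathcal{D}$ admits a homological modulus $\mu$ over $k$, then $\mathcal{D}$ admits an effective context over $k$ refining $\mu$.
   Context: For objects $x,y\in\mathcal{D}$, let $S(x,y)$ be the set of morphisms $x\to x$ that factor through $y$. For $d\in\mathcal{D}$ and $s\in S(x,y)$, let $M_s$ be the square $0$-$1$ matrix over $k$ with rows and columns indexed by $\operatorname{Hom}_{\mathcal{D}}(d,x)$, whose $(f,g)$ entry is $1$ if $s\circ f=g$ and $0$ otherwise. Write $x\leq_d y$ if the identity matrix lies in the $k$-span (finite $k$-linear combinations) of the matrices $M_s$, $s\in S(x,y)$. A homological modulus for $\mathcal{D}$ over $k$ is a function $\mu$ from objects of $\mathcal{D}$ to finite subsets of $\operatorname{Ob}(\mathcal{D})$ such that for every $d,x\in\mathcal{D}$ there exists $y\in\mu(d)$ with $x\leq_d y$. An effective context refining $\mu$ consists of the following data for every pair of objects $d,x\in\mathcal{D}$: a natural number $\kappa$; a $\kappa$-tuple $m=(m_1,\dots,m_\kappa)$ of objects $m_i\in\mu(d)$; a $\kappa$-tuple $\alpha=(\alpha_1,\dots,\alpha_\kappa)$ of finitely-supported functions $\alpha_i:\operatorname{Hom}_{\mathcal{D}}(x,m_i)\to k$; and a $\kappa$-tuple $\beta=(\beta_1,\dots,\beta_\kappa)$ of finitely-supported functions $\beta_i:\operatorname{Hom}_{\mathcal{D}}(m_i,x)\to k$; with the requirement that for every pair of arrows $f,g:d\to x$, $$\sum_{i=1}^{\kappa}\ \sum_{\substack{p:x\to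 m_i,\ q:m_i\to x\\ q\circ p\circ f=g}}\alpha_i(p)\,\beta_i(q)=\begin{cases}1 & f=g,\\ 0 & f\neq g.\end{cases}$$ *)

(* Defs.v *)
From HB Require Import structures.
From mathcomp Require Import all_boot all_order all_algebra.
From mathcomp Require Import all_classical.
Unset Printing Implicit Defensive.
Import GRing.Theory.
Local Open Scope classical_set_scope.
Local Open Scope ring_scope.

Record category := Category {
  obj :> Type;
  mor : obj -> obj -> Type;
  mor_id : forall x, mor x x;
  mor_comp : forall {x y z}, mor y z -> mor x y -> mor x z;
  mor_comp_id_left : forall x y (f : mor x y), mor_comp (mor_id y) f = f;
  mor_comp_id_right : forall x y (f : mor x y), mor_comp f (mor_id x) = f;
  mor_comp_assoc : forall w x y z (h : mor y z) (g : mor x y) (f : mor w x),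
    mor_comp h (mor_comp g f) = mor_comp (mor_comp h g) f
}.

Arguments mor {_} x y.
Arguments mor_id {_} x.
Arguments mor_comp {_ x y z} g f.

Definition linear_span {R : pzRingType} {V : lmodType R} (A : set V) : set V :=
  [set v | exists (n : nat) (c : 'I_n -> R) (a : 'I_n -> V),
    (forall i, A (a i)) /\ v = \sum_(i < n) c i *: a i].

Definition factoring {D : category} (x y : D) : set (mor x x) :=
  [set s | exists (p : mor x y) (q : mor y x), s = mor_comp q p].

Section HomologicalModulus.
Context (k : comPzRingType) {D : category}.

(* The index set I may be infinite, so a matrix is a function of two indices;
   'M[k]_n would not apply.  The module structure is pointwise. *)
Definition square_matrix (I : Type) : lmodType k := I -> I -> k^o.

Definition identity_matrix (I : Type) : square_matrix I :=
  fun f g => if `[< f = g >] then 1 else 0.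

Definition action_matrix (d : D) {x : D} (s : mor x x) : square_matrix (mor d x) :=
  fun f g => if `[< mor_comp s f = g >] then 1 else 0.

Definition le_at (d x y : D) : Prop :=
  linear_span [set action_matrix d s | s in factoring x y]
    (identity_matrix (mor d x)).

Definition homological_modulus (mu : D -> set D) : Prop :=
  (forall d, finite_set (mu d)) /\
  (forall d x, exists y, mu d y /\ le_at d x y).

(* [\sum_(i \in A) F i] from fsbigop is the sum over the members of A at which F
   is nonzero, provided these are finitely many; here they are, by
   [ctx_alpha_finite] and [ctx_beta_finite].  It needs a choiceType of indices,
   whence [{classic _}], which leaves the underlying type unchanged. *)
Record effective_context_at (mu : D -> set D) (d x : D) := EffectiveContextAt {
  ctx_kappa : nat;
  ctx_m : 'I_ctx_kappa -> D;
  ctx_alpha : forall i, mor x (ctx_m i) -> k;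
  ctx_beta : forall i, mor (ctx_m i) x -> k;
  ctx_m_in : forall i, mu d (ctx_m i);
  ctx_alpha_finite : forall i, finite_set [set p | ctx_alpha i p <> 0];
  ctx_beta_finite : forall i, finite_set [set q | ctx_beta i q <> 0];
  ctx_eq : forall f g : mor d x,
    \sum_(i < ctx_kappa)
      \sum_(pq \in [set pq : {classic mor x (ctx_m i)} * {classic mor (ctx_m i) x}
                      | mor_comp pq.2 (mor_comp pq.1 f) = g])
        (ctx_alpha i pq.1 * ctx_beta i pq.2)
    = if `[< f = g >] then 1 else 0
}.

Definition effective_context (mu : D -> set D) : Type :=
  forall d x : D, effective_context_at mu d x.

End HomologicalModulus.

(* Main.v *)
Require Import Defs.
From mathcomp Require Import all_boot all_order all_algebra.
From mathcomp Require Import all_classical.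

(** A relation [le_at k d x y] already is an effective context at [d] and [x].
    It writes the identity matrix as a finite combination of matrices of
    endomorphisms [q_i \o p_i] with [p_i : x -> y] and [q_i : y -> x].  Take one
    index for each term, all with the object [y], put the whole coefficient on
    [p_i] and the weight [1] on [q_i]: the [i]-th double sum of the context then
    has at most one nonzero term ([sum_point_masses]), and equals the [(f, g)] entry
    of the [i]-th term of that combination.  The modulus provides such a [y] in [mu d], and choice
    makes the selection uniform in [d] and [x]. *)

Import GRing.Theory.
Local Open Scope classical_set_scope.
Local Open Scope ring_scope.

Definition point_mass {k : comPzRingType} {T : Type} (c : k) (a t : T) : k :=
  if `[< t = a >] then c else 0.

Lemma point_mass_diag {k : comPzRingType} {T : Type} (c : k) (a : T) :
  point_mass c a a = c.
Proof. by rewrite /point_mass asboolT. Qed.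

Lemma point_mass_neq {k : comPzRingType} {T : Type} (c : k) {a t : T} :
  t <> a -> point_mass c a t = 0.
Proof. by move=> ta; rewrite /point_mass asboolF. Qed.

Lemma finite_support_point_mass {k : comPzRingType} {T : Type} (c : k) (a : T) :
  finite_set [set t | point_mass c a t <> 0].
Proof.
apply: (@sub_finite_set _ _ [set a]); last exact: finite_set1.
move=> t /= ct; apply: contrapT => ta; exact: ct (point_mass_neq _ ta).
Qed.

(** The product of two point masses is supported at the single pair [(a, b)],
    so the sum over [A] only tests whether [A] contains it. *)
Lemma sum_point_masses {k : comPzRingType} {S T : Type} (A : set (S * T))
    (c e : k) (a : S) (b : T) :
  \sum_(st \in (A : set ({classic S} * {classic T})))
     (point_mass c a st.1 * point_mass e b st.2)
  = if `[< A (a, b) >] then c * e else 0.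
Proof.
have off_point (st : {classic S} * {classic T}) : st <> (a, b) ->
    point_mass c a st.1 * point_mass e b st.2 = 0.
  case: st => s t st_neq /=; have [sa|/(point_mass_neq c)->] := pselect (s = a).
    rewrite [X in _ * X]point_mass_neq ?mulr0// => tb.
    by apply: st_neq; rewrite sa tb.
  by rewrite mul0r.
case: asboolP => [Aab|nAab]; last first.
  by apply: fsbig1 => st Ast; apply: off_point => st_ab; rewrite st_ab in Ast.
rewrite -(@fsbig_widen _ _ _ _ [set ((a, b) : {classic S} * {classic T})]).
- by rewrite fsbig_set1 /= !point_mass_diag.
- by move=> _ ->.
- by move=> st [_ /= st_ab]; apply: off_point.
Qed.

(** Every factorization [q_i \o p_i] passes through the same object [y], so the
    tuple of objects of the context is constant. *)
Lemma effective_context_at_of_le {k : comPzRingType} {D : category}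
    (mu : D -> set D) (d x y : D) :
  mu d y -> le_at k d x y -> effective_context_at k mu d x.
Proof.
move=> mu_y /cid[n /cid[c /cid[M [M_action id_sum]]]].
have /choice[pq pqE] (i : 'I_n) : exists pq : mor x y * mor y x,
    M i = action_matrix k d (mor_comp pq.2 pq.1).
  by have [_ [p [q ->]] <-] := M_action i; exists (p, q).
apply: (@EffectiveContextAt k D mu d x n (fun=> y)
  (fun i => point_mass (c i) (pq i).1) (fun i => point_mass 1 (pq i).2)) => //.
- by move=> i; apply: finite_support_point_mass.
- by move=> i; apply: finite_support_point_mass.
move=> f g.
have := congr1 (fun N : square_matrix k (mor d x) => N f g) id_sum.
rewrite /identity_matrix /= => ->.
rewrite !fct_sumE; apply: eq_bigr => i _.
rewrite sum_point_masses pqE /= mor_comp_assoc.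
(* Scaling in the module of matrices is entrywise multiplication in [k]. *)
rewrite -[RHS]/(c i * action_matrix k d _ f g) /action_matrix.
by case: asbool; rewrite ?mulr1 ?mulr0.
Qed.

Theorem proposition1p14 (k : comPzRingType) (D : category) (mu : D -> set D)
    (mu_modulus : homological_modulus k mu) :
  inhabited (effective_context k mu).
Proof.
have [_ mu_le] := mu_modulus.
constructor=> d x; have /cid[y [mu_y le_y]] := mu_le d x.
exact: effective_context_at_of_le mu_y le_y.
Qed.
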